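(* Let $I\subset(0,\infty)$ be an interval and let $f:I\to\mathbb{R}$ be differentiable on the interior $I^\circ$ of $I$. Let $m\in(0,1]$, $\alpha\in[0,1]$, $q\ge 1$ and $\theta>0$, and let $a,b$ be real numbers with $a<b$ and $a,\,b/m\in I^\circ$, such that $f'\in L[a,b]$. Suppose that $|f'|^q$ is harmonically $(\alpha,m)$-convex on $[a,b/m]$. Then $$\left|I_f(g;\theta,a,b)\right|\le \frac{ab(b-a)}{2}\,C_1(\theta;a,b)^{1-1/q}\left[C_2(\theta;\alpha;a,b)\,|f'(a)|^q+m\,C_3(\theta;\alpha;a,b)\,|f'(b/m)|^q\right]^{1/q},$$ where $$C_1(\theta;a,b)=\frac{b^{-2}}{\theta+1}\left[{}_2F_1\!\left(2,\theta+1;\theta+2;1-\tfrac{a}{b}\right)+{}_2F_1\!\left(2,1;\theta+2;1-\tfrac{a}{b}\right)\right],$$ $$C_2(\theta;\alpha;a,b)=\frac{\beta(\theta+1,\alpha+1)}{b^{2}}\,{}_2F_1\!\left(2,\theta+1;\theta+\alpha+2;1-\tfrac{a}{b}\right)+\frac{b^{-2}}{\theta+\alpha+1}\,{}_2F_1\!\left(2,1;\theta+\alpha+2;1-\tfrac{a}{b}\right),$$ $$C_3(\theta;\alpha;a,b)=C_1(\theta;a,b)-C_2(\theta;\alpha;a,b).$$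
   Context: A function $h:J\to\mathbb{R}$ on an interval $J\subset(0,\infty)$ is called harmonically $(\alpha,m)$-convex (with $\alpha\in[0,1]$, $m\in(0,1]$) if $h\left(\frac{mxy}{mty+(1-t)x}\right)\le t^{\alpha}h(x)+m(1-t^{\alpha})h(y)$ for all $x,y\in J$ and $t\in[0,1]$ (for which the left-hand side is defined, i.e. the argument lies in $J$). For $\varphi\in L[c,d]$ and $\theta>0$ the Riemann–Liouville integrals are $J^{\theta}_{c+}\varphi(x)=\frac{1}{\Gamma(\theta)}\int_c^x (x-t)^{\theta-1}\varphi(t)\,dt$ for $x>c$ and $J^{\theta}_{d-}\varphi(x)=\frac{1}{\Gamma(\theta)}\int_x^d (t-x)^{\theta-1}\varphi(t)\,dt$ for $x<d$, where $\Gamma$ is the Euler Gamma function. With $g(x)=1/x$, define $$I_f(g;\theta,a,b)=\frac{f(a)+f(b)}{2}-\frac{\Gamma(\theta+1)}{2}\left(\frac{ab}{b-a}\right)^{\theta}\left\{J^{\theta}_{1/a-}(f\circ g)(1/b)+J^{\theta}_{1/b+}(f\circ g)(1/a)\right\}.$$ $\beta(x,y)=\int_0^1 t^{x-1}(1-t)^{y-1}dt$ ($x,y>0$) is the Beta function, and the hypergeometric function is ${}_2F_1(a,b;c;z)=\frac{1}{\beta(b,c-b)}\int_0^1 t^{b-1}(1-t)^{c-b-1}(1-zt)^{-a}dt$ for $c>b>0$, $|z|<1$. *)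

(* Defs.v *)
From HB Require Import structures.
From mathcomp Require Import all_boot all_order all_algebra.
From mathcomp Require Import all_classical all_reals all_analysis.
Set Implicit Arguments. Unset Strict Implicit. Unset Printing Implicit Defensive.
Import Order.TTheory GRing.Theory Num.Theory.
Import numFieldNormedType.Exports.
Local Open Scope classical_set_scope.
Local Open Scope ring_scope.

Section Defs.
Variable R : realType.
Local Notation mu := (@lebesgue_measure R).

Definition Gamma (x : R) : R :=
  Rintegral mu `]0, +oo[ (fun t => t `^ (x - 1) * expR (- t)).

Definition Beta (x y : R) : R :=
  Rintegral mu `]0, 1[ (fun t => t `^ (x - 1) * (1 - t) `^ (y - 1)).

(* Hypergeometric function via Euler's integral representation (c > b > 0, |z| < 1) *)
Definition hyp2F1 (a b c z : R) : R :=
  (Beta b (c - b))^-1 *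
  Rintegral mu `]0, 1[
    (fun t => t `^ (b - 1) * (1 - t) `^ (c - b - 1) * (1 - z * t) `^ (- a)).

Definition RL_left (theta c : R) (phi : R -> R) (x : R) : R :=
  (Gamma theta)^-1 * Rintegral mu `[c, x] (fun t => (x - t) `^ (theta - 1) * phi t).

Definition RL_right (theta d : R) (phi : R -> R) (x : R) : R :=
  (Gamma theta)^-1 * Rintegral mu `[x, d] (fun t => (t - x) `^ (theta - 1) * phi t).

Definition harm_am_convex (alpha m : R) (J : set R) (h : R -> R) : Prop :=
  forall x y t, J x -> J y -> 0 <= t <= 1 ->
    J (m * x * y / (m * t * y + (1 - t) * x)) ->
    h (m * x * y / (m * t * y + (1 - t) * x))
      <= t `^ alpha * h x + m * (1 - t `^ alpha) * h y.

(* I_f(g; theta, a, b) with g x = 1/x *)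
Definition If (f : R -> R) (theta a b : R) : R :=
  (f a + f b) / 2 - Gamma (theta + 1) / 2 * (a * b / (b - a)) `^ theta *
    (RL_right theta (1 / a) (f \o (fun x => 1 / x)) (1 / b)
     + RL_left theta (1 / b) (f \o (fun x => 1 / x)) (1 / a)).

Definition C1 (theta a b : R) : R :=
  (b ^+ 2)^-1 / (theta + 1) *
  (hyp2F1 2 (theta + 1) (theta + 2) (1 - a / b) + hyp2F1 2 1 (theta + 2) (1 - a / b)).

Definition C2 (theta alpha a b : R) : R :=
  Beta (theta + 1) (alpha + 1) / b ^+ 2 *
    hyp2F1 2 (theta + 1) (theta + alpha + 2) (1 - a / b)
  + (b ^+ 2)^-1 / (theta + alpha + 1) *
    hyp2F1 2 1 (theta + alpha + 2) (1 - a / b).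

Definition C3 (theta alpha a b : R) : R := C1 theta a b - C2 theta alpha a b.

End Defs.

(* Main.v *)
Require Import Defs.
From HB Require Import structures.
From mathcomp Require Import all_boot all_order all_algebra.
From mathcomp Require Import all_classical all_reals all_analysis.
From mathcomp Require Import measurable_realfun ring lra.
Import Order.TTheory GRing.Theory Num.Theory.
Import numFieldNormedType.Exports.
Local Open Scope classical_set_scope.
Local Open Scope ring_scope.

(** Put [c = 1/b], [d = 1/a], [phi x = f (1/x)] and
    [P x = ((x-c)^theta - (d-x)^theta) phi x
           - theta \int_c^x ((t-c)^(theta-1) + (d-t)^(theta-1)) phi t dt].
    Then [P' = ((x-c)^theta - (d-x)^theta) phi'], and [P d - P c] is
    [2 (d-c)^theta If] because [Gamma (theta+1) = theta Gamma theta].  Hence any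
    [Q] with [|P'| <= Q'] bounds [If] by [Q d - Q c], and no integral of [f'] is
    ever needed.  Convexity bounds [|f'|^q] at [ab/(ta+(1-t)b)] by
    [K t = (1-t)^alpha |f' a|^q + m (1-(1-t)^alpha) |f' (b/m)|^q], and Young's
    inequality turns this, for each [s > 0], into the bound
    [|f'| <= s ((1-1/q) + K t / (q s^q))], which is linear in [K]; its integral
    against the kernel is a combination of [C1], [C2], [C3].  Optimising over [s]
    replaces the power-mean inequality. *)

(** * Real powers, and integrability of a nonnegative derivative *)

Section powers.
Context {R : realType}.
Local Notation mu := (@lebesgue_measure R).
Implicit Types (a b c d p x y : R) (f F : R -> R).

(** For negative [x] the power [powR x p] is 1 by convention, a jump at 0 when [p > 0]. The absolute
    value removes it and gives a globally continuous function to restrict to intervals. *)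
Lemma continuous_normr_powR p : 0 <= p ->
  continuous (fun x : R => `|x| `^ p).
Proof.
rewrite le_eqVlt => /predU1P[<-|p0] x.
  under eq_fun do rewrite powRr0.
  exact: cvg_cst.
have [->|x0] := eqVneq x 0; last first.
  apply: (@continuous_comp R R R (fun y : R => `|y|) (fun y : R => y `^ p)).
    exact: norm_continuous.
  apply/differentiable_continuous/derivable1_diffP.
  by apply: derivable_powR; rewrite in_itv/= andbT normr_gt0.
apply/cvgrPdist_lt => e e0; rewrite normr0 powR0 ?gt_eqF//.
have ep : 0 < e `^ p^-1 by rewrite powR_gt0.
near=> y; rewrite sub0r normrN ger0_norm ?powR_ge0//.
rewrite -[ltRHS]powRr1 ?ltW// -(mulVf (lt0r_neq0 p0)) powRrM.
rewrite gt0_ltr_powR ?nnegrE ?powR_ge0//.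
Unshelve. all: by end_near. Qed.

Lemma within_continuous_powR_subl a b p : 0 <= p ->
  {within `[a, b], continuous (fun x => (x - a) `^ p)}.
Proof.
move=> p0; apply: (@subspace_eq_continuous _ _ _ (fun x => `|x - a| `^ p)).
  by move=> x; rewrite inE/= in_itv/= => /andP[ax _]; rewrite ger0_norm// subr_ge0.
apply: continuous_subspaceT => x.
apply: (@continuous_comp R R R (fun x : R => x - a) (fun x : R => `|x| `^ p)).
  by apply: continuousB => //; exact: cvg_cst.
exact: continuous_normr_powR.
Qed.

Lemma within_continuous_powR_subr a b p : 0 <= p ->
  {within `[a, b], continuous (fun x => (b - x) `^ p)}.
Proof.
move=> p0; apply: (@subspace_eq_continuous _ _ _ (fun x => `|b - x| `^ p)).
  by move=> x; rewrite inE/= in_itv/= => /andP[_ xb]; rewrite ger0_norm// subr_ge0.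
apply: continuous_subspaceT => x.
apply: (@continuous_comp R R R (fun x : R => b - x) (fun x : R => `|x| `^ p)).
  by apply: continuousB => //; exact: cvg_cst.
exact: continuous_normr_powR.
Qed.

Lemma is_derive_powR_subl a p x : a < x ->
  is_derive x 1 (fun y => (y - a) `^ p) (p * (x - a) `^ (p - 1)).
Proof.
move=> ax; have xa : 0 < x - a by rewrite subr_gt0.
have h : is_derive x 1 (fun y : R => y - a) 1.
  by apply: is_derive_eq; rewrite subr0.
have := @is_derive1_comp _ (fun y : R => y `^ p) _ x _ _ (is_derive1_powR p xa) h.
by rewrite mulr1.
Qed.

Lemma is_derive_powR_subr b p x : x < b ->
  is_derive x 1 (fun y => (b - y) `^ p) (- (p * (b - x) `^ (p - 1))).
Proof.
move=> xb; have bx : 0 < b - x by rewrite subr_gt0.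
have h : is_derive x 1 (fun y : R => b - y) (-1).
  by apply: is_derive_eq; rewrite add0r mul1r.
have := @is_derive1_comp _ (fun y : R => y `^ p) _ x _ _ (is_derive1_powR p bx) h.
by rewrite mulrN1.
Qed.

(* The partial integrals over [a + e n, b - e n] are bounded by F b - F a. *)
Lemma ge0_derive_integrable a b F f : a < b ->
  {within `[a, b], continuous F} ->
  (forall x, x \in `]a, b[ -> is_derive x 1 F (f x)) ->
  {in `]a, b[, continuous f} ->
  (forall x, x \in `]a, b[ -> 0 <= f x) ->
  mu.-integrable `]a, b[ (EFin \o f).
Proof.
move=> ab cF dF cf f0.
(* With [n.+3] the two margins take up at most 2/3 of the length, so every [E n] has positive
   length. *)
pose e n := (b - a) / n.+3%:R.
have e0 n : 0 < e n by rewrite divr_gt0// subr_gt0.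
have eab n : a + e n < b - e n.
  rewrite -subr_gt0 (_ : _ - _ = (b - a) * (1 - 2 / n.+3%:R)); last by rewrite /e; field.
  by rewrite mulr_gt0 ?subr_gt0// ltr_pdivrMr// mul1r ltr_nat.
have dece : nonincreasing_seq e.
  by move=> i j ij; rewrite /e ler_pM2l ?subr_gt0// lef_pV2 ?posrE// ler_nat.
pose E n := `[a + e n, b - e n]%classic.
have EI n : E n `<=` `]a, b[.
  move=> x; rewrite /E/= !in_itv/= => /andP[h1 h2]; have := e0 n; lra.
have mf : measurable_fun `]a, b[ f.
  apply: subspace_continuous_measurable_fun => //.
  by apply: continuous_in_subspaceT => x /set_mem; exact: cf.
have UE : \bigcup_n E n = `]a, b[%classic.
  apply/seteqP; split => [x [n _] /EI//|x /=].
  rewrite in_itv/= => /andP[ax xb].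
  have m0 : 0 < Num.min (x - a) (b - x) by rewrite lt_min !subr_gt0 ax.
  have := archi_boundP (ltW (divr_gt0 _ m0 : 0 < (b - a) / Num.min (x - a) (b - x))).
  rewrite subr_gt0 => /(_ ab); set N := Num.bound _ => hN.
  exists N => //; rewrite /E/= in_itv/=.
  have : e N <= Num.min (x - a) (b - x).
    rewrite /e ler_pdivrMr// mulrC -ler_pdivrMr// (le_trans (ltW hN))// ler_nat.
    exact: (leq_addl 3).
  by rewrite le_min => /andP[h1 h2]; apply/andP; split; lra.
have ndF : forall x y, a <= x -> x <= y -> y <= b -> F x <= F y.
  apply: ger0_derive1_ndecr => // x xab; first by have [] := dF _ xab.
  by rewrite derive1E (@derive_val _ _ _ _ _ _ _ (dF _ xab)) f0.
have intE n : (\int[mu]_(x in E n) (f x)%:E <= (F b - F a)%:E)%E.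
  rewrite (@continuous_FTC2 _ f F) //.
  - rewrite -EFinB lee_fin; apply: lerB; apply: ndF; have := e0 n; have := eab n; lra.
  - apply: continuous_in_subspaceT => x /set_mem /EI; exact: cf.
  - have sub : {subset `](a + e n), (b - e n)[ <= `]a, b[}.
      move=> x; rewrite !in_itv/= => /andP[h1 h2]; have := e0 n; lra.
    split.
    + by move=> x /sub /dF [].
    + have /dF[+ _] : a + e n \in `]a, b[.
        by rewrite in_itv/=; have := e0 n; have := eab n; lra.
      by move=> /derivable1_diffP/differentiable_continuous; exact: cvg_at_right_filter.
    + have /dF[+ _] : b - e n \in `]a, b[.
        by rewrite in_itv/=; have := e0 n; have := eab n; lra.
      by move=> /derivable1_diffP/differentiable_continuous; exact: cvg_at_left_filter.
  - move=> x; rewrite in_itv/= => h.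
    have xab : x \in `]a, b[ by rewrite in_itv/=; have := e0 n; lra.
    by rewrite derive1E (@derive_val _ _ _ _ _ _ _ (dF _ xab)).
apply/integrableP; split; first exact/measurable_EFinP.
apply: (@le_lt_trans _ _ (F b - F a)%:E); last exact: ltry.
rewrite [leLHS](_ : _ = (\int[mu]_(x in `]a, b[) (f x)%:E)%E); last first.
  by apply: eq_integral => x; rewrite inE/= => xab; rewrite ger0_norm// f0.
rewrite -UE.
(* Monotone convergence carries the uniform bound [intE] to the union. *)
have cvgE : (\int[mu]_(x in E i) (f x)%:E)%E @[i --> \oo] -->
   (\int[mu]_(x in \bigcup_i E i) (f x)%:E)%E.
  apply: ge0_nondecreasing_set_cvg_integral => //.
  - move=> i j ij; apply/subsetPset => x; rewrite /E/= !in_itv/=.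
    have := dece _ _ ij; lra.
  - by move=> i; exact: measurable_itv.
  - by move=> i; apply/measurable_EFinP; apply: measurable_funS mf => //; exact: EI.
  - by move=> i x /EI xab; rewrite lee_fin f0.
rewrite -(cvg_lim _ cvgE)//.
by apply: lime_le; [apply/cvg_ex; eexists; exact: cvgE|exact: nearW].
Qed.

End powers.

(** * Trapezoid estimate for Riemann-Liouville integrals *)

Section trapezoid.
Context {R : realType}.
Local Notation mu := (@lebesgue_measure R).
Implicit Types (a b c d p x y theta : R) (f F P Q phi : R -> R).

Lemma is_derive1_continuous f x df : is_derive x 1 f df ->
  {for x, continuous f}.
Proof. by case=> /derivable1_diffP/differentiable_continuous. Qed.

Lemma integrable_itv_oo_cc a b f :
  measurable_fun [set: R] f ->
  mu.-integrable `]a, b[ (EFin \o f) -> mu.-integrable `[a, b] (EFin \o f).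
Proof.
move=> mf /integrableP[_ ifoo].
have mEf D : measurable_fun D (EFin \o f).
  by apply/measurable_EFinP; exact: measurable_funTS.
apply/integrableP; split; first exact: mEf.
apply: le_lt_trans ifoo; rewrite le_eqVlt; apply/orP; left; apply/eqP.
have mabs D : measurable_fun D (fun x : R => `|(f x)%:E|%E).
  exact: measurableT_comp.
transitivity (\int[mu]_(x in `[a, b[) `|(f x)%:E|)%E.
  by rewrite -integral_itv_bndo_bndc.
by rewrite -integral_itv_obnd_cbnd.
Qed.

(** For [theta < 1] the kernel blows up at [c], but [theta] times it is the nonnegative derivative
    of [(x - c)^theta], which is continuous up to [c]. *)
Lemma integrable_powR_subl c d theta : c < d -> 0 < theta ->
  mu.-integrable `[c, d] (EFin \o (fun x => (x - c) `^ (theta - 1))).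
Proof.
move=> cd th0; apply: integrable_itv_oo_cc.
  apply: (@measurableT_comp _ _ _ _ _ _ (fun x : R => x `^ (theta - 1))).
    exact: measurable_powR.
  by apply: measurable_funB => //; exact: measurable_cst.
have := @ge0_derive_integrable R c d (fun x => (x - c) `^ theta)
  (fun x => theta * (x - c) `^ (theta - 1)) cd.
move=> /(_ (within_continuous_powR_subl _ _ _ (ltW th0))) h.
have {}h : mu.-integrable `]c, d[ (EFin \o (fun x => theta * (x - c) `^ (theta - 1))).
  apply: h.
  - by move=> x; rewrite in_itv/= => /andP[cx _]; exact: is_derive_powR_subl.
  - move=> x; rewrite in_itv/= => /andP[cx _].
    apply: cvgM; first exact: cvg_cst.
    exact: is_derive1_continuous (is_derive_powR_subl c (theta - 1) x cx).
  - by move=> x _; rewrite mulr_ge0 ?powR_ge0 ?ltW.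
have : mu.-integrable `]c, d[ (fun x => theta^-1%:E *
    (theta * (x - c) `^ (theta - 1))%:E)%E by exact: integrableZl.
apply: eq_integrable => // x _ /=.
by rewrite -EFinM mulrA mulVf ?gt_eqF// mul1r.
Qed.

Lemma integrable_powR_subr c d theta : c < d -> 0 < theta ->
  mu.-integrable `[c, d] (EFin \o (fun x => (d - x) `^ (theta - 1))).
Proof.
move=> cd th0; apply: integrable_itv_oo_cc.
  apply: (@measurableT_comp _ _ _ _ _ _ (fun x : R => x `^ (theta - 1))).
    exact: measurable_powR.
  by apply: measurable_funB => //; exact: measurable_cst.
have := @ge0_derive_integrable R c d (fun x => - (d - x) `^ theta)
  (fun x => theta * (d - x) `^ (theta - 1)) cd.
have cN : {within `[c, d], continuous (fun x => - (d - x) `^ theta)}.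
  by move=> /= x; apply: cvgN; exact: within_continuous_powR_subr (ltW th0) x.
move=> /(_ cN) h.
have {}h : mu.-integrable `]c, d[ (EFin \o (fun x => theta * (d - x) `^ (theta - 1))).
  apply: h.
  - move=> x; rewrite in_itv/= => /andP[_ xd].
    have := is_derive_powR_subr d theta x xd => h.
    by apply: is_derive_eq; rewrite opprK.
  - move=> x; rewrite in_itv/= => /andP[_ xd].
    apply: cvgM; first exact: cvg_cst.
    exact: is_derive1_continuous (is_derive_powR_subr d (theta - 1) x xd).
  - by move=> x _; rewrite mulr_ge0 ?powR_ge0 ?ltW.
have : mu.-integrable `]c, d[ (fun x => theta^-1%:E *
    (theta * (d - x) `^ (theta - 1))%:E)%E by exact: integrableZl.
apply: eq_integrable => // x _ /=.
by rewrite -EFinM mulrA mulVf ?gt_eqF// mul1r.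
Qed.

Lemma integrable_mul_continuous c d f phi :
  mu.-integrable `[c, d] (EFin \o f) -> {within `[c, d], continuous phi} ->
  mu.-integrable `[c, d] (EFin \o (fun x => f x * phi x)).
Proof.
move=> intf cphi.
apply: (integrableMl _ intf) => //.
  exact: subspace_continuous_measurable_fun.
have := continuous_compact cphi (@segment_compact R c d).
move=> /compact_bounded [M [Mr hM]]; exists M; split => // N MN x xab /=.
by apply: hM => //; exists x.
Qed.

(** Both [Q - P] and [Q + P] have a nonnegative derivative, hence are nondecreasing. This stands in
    for bounding an integral of [dP] by one of [dQ]. *)
Lemma ler_norm_derive_bound P dP Q dQ c d : c < d ->
  {within `[c, d], continuous P} -> {within `[c, d], continuous Q} ->
  (forall x, x \in `]c, d[ -> is_derive x 1 P (dP x)) ->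
  (forall x, x \in `]c, d[ -> is_derive x 1 Q (dQ x)) ->
  (forall x, x \in `]c, d[ -> `|dP x| <= dQ x) ->
  `|P d - P c| <= Q d - Q c.
Proof.
move=> cd cP cQ hP hQ hPQ.
have h1 : Q c - P c <= Q d - P d.
  apply: (@ger0_derive1_ndecr _ (fun x => Q x - P x) c d) => //; last 2 first.
  - by move=> /= x; apply: cvgB; [exact: cQ|exact: cP].
  - exact: ltW.
  - by move=> x /[dup] /hP [? _] /hQ [? _]; exact: derivableB.
  - move=> x xcd; have := hP _ xcd; have := hQ _ xcd => Hq Hp.
    rewrite derive1E derive_val subr_ge0.
    by rewrite (le_trans (ler_norm _))// hPQ.
have h2 : Q c + P c <= Q d + P d.
  apply: (@ger0_derive1_ndecr _ (fun x => Q x + P x) c d) => //; last 2 first.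
  - by move=> /= x; apply: cvgD; [exact: cQ|exact: cP].
  - exact: ltW.
  - by move=> x /[dup] /hP [? _] /hQ [? _]; exact: derivableD.
  - move=> x xcd; have := hP _ xcd; have := hQ _ xcd => Hq Hp.
    rewrite derive1E derive_val -[X in _ + X]opprK subr_ge0.
    by rewrite (le_trans (ler_norm _))// normrN hPQ.
by rewrite ler_norml; apply/andP; split; lra.
Qed.

Lemma RL_trapezoid_bound c d theta phi dphi Q dQ : c < d -> 0 < theta ->
  {within `[c, d], continuous phi} ->
  (forall x, x \in `]c, d[ -> is_derive x 1 phi (dphi x)) ->
  {within `[c, d], continuous Q} ->
  (forall x, x \in `]c, d[ -> is_derive x 1 Q (dQ x)) ->
  (forall x, x \in `]c, d[ ->
    `|((x - c) `^ theta - (d - x) `^ theta) * dphi x| <= dQ x) ->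
  `|(d - c) `^ theta * (phi c + phi d) -
    theta * (\int[mu]_(x in `[c, d]) ((x - c) `^ (theta - 1) * phi x) +
             \int[mu]_(x in `[c, d]) ((d - x) `^ (theta - 1) * phi x))|
  <= Q d - Q c.
Proof.
move=> cd th0 cphi hphi cQ hQ hle.
have i1 := integrable_mul_continuous _ _ _ _ (integrable_powR_subl _ _ _ cd th0) cphi.
have i2 := integrable_mul_continuous _ _ _ _ (integrable_powR_subr _ _ _ cd th0) cphi.
pose k x := (x - c) `^ (theta - 1) * phi x + (d - x) `^ (theta - 1) * phi x.
have ik : mu.-integrable `[c, d] (EFin \o k).
  exact: (integrableD _ i1 i2).
pose H x := parameterized_integral mu c x k.
have cH : {within `[c, d], continuous H}.
  by apply: parameterized_integral_continuous; rewrite ?ltW.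
have cpl := within_continuous_powR_subl c d theta (ltW th0).
have cpr := within_continuous_powR_subr c d theta (ltW th0).
(* In the derivative of [P] the terms carrying [phi x] cancel against [theta * k x]. At the ends
   [P c = - (d - c)^theta * phi c], while [P d] is [(d - c)^theta * phi d] minus [theta] times the
   full integral of [k]. *)
pose P x := ((x - c) `^ theta - (d - x) `^ theta) * phi x - theta * H x.
have cP : {within `[c, d], continuous P}.
  move=> /= x; apply: cvgB; apply: cvgM.
  - by apply: cvgB; [exact: cpl|exact: cpr].
  - exact: cphi.
  - exact: cvg_cst.
  - exact: cH.
have hP x : x \in `]c, d[ ->
    is_derive x 1 P (((x - c) `^ theta - (d - x) `^ theta) * dphi x).
  move=> /[dup] xcd; rewrite in_itv/= => /andP[cx xd].
  have dphix := hphi _ xcd.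
  have d1 := is_derive_powR_subl c theta x cx.
  have d2 := is_derive_powR_subr d theta x xd.
  have dH : is_derive x 1 H (k x).
    have ck : {for x, continuous k}.
      apply: cvgD; apply: cvgM; try exact: is_derive1_continuous dphix.
        exact: is_derive1_continuous (is_derive_powR_subl c (theta - 1) x cx).
      exact: is_derive1_continuous (is_derive_powR_subr d (theta - 1) x xd).
    have [dH1 dH2] := continuous_FTC1_closed xd ik cx ck.
    by split; [exact: dH1|rewrite -derive1E; exact: dH2].
  apply: is_derive_eq; rewrite /k /GRing.scale/=; ring.
have := ler_norm_derive_bound _ _ _ _ _ _ cd cP cQ hP hQ hle.
rewrite /P /H /parameterized_integral !subrr powR0 ?gt_eqF//.
rewrite set_itv1 Rintegral_set1 /k RintegralD//.
set I1 := Rintegral _ _ _; set I2 := Rintegral _ _ _.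
by congr (`| _ | <= _); move: I1 I2 => I1 I2; ring.
Qed.

End trapezoid.

(** * The Gamma function: positivity and functional equation *)

Section gamma.
Context {R : realType}.
Local Notation mu := (@lebesgue_measure R).
Implicit Types (a b c d p x y t theta : R) (f F P Q phi : R -> R).

(** The integrand of [Gamma (p + 1)]. *)
Let g p t := t `^ p * expR (- t).

(** From [u <= 1 + u <= exp u] at [u = t / (2 theta)], raised to the power [theta]. Half of the
    exponential decay is kept, which is still integrable on the half-line. *)
Lemma powR_mul_expRN_le theta t : 0 < theta -> 0 <= t ->
  t `^ theta * expR (- t) <= (2 * theta) `^ theta * expR (- (t / 2)).
Proof.
move=> th0 t0.
have -> : expR (- (t / 2)) = expR (t / 2) * expR (- t).
  by rewrite -expRD; congr expR; lra.
rewrite mulrA ler_pM2r ?expR_gt0//.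
have -> : expR (t / 2) = expR (t / (2 * theta)) `^ theta.
  by rewrite -expRM; congr expR; field; rewrite gt_eqF.
have th2 : 0 < 2 * theta by rewrite mulr_gt0.
rewrite -powRM ?expR_ge0 ?(ltW th2)//.
have e0 := expR_ge0 (t / (2 * theta)).
apply: ge0_ler_powR; rewrite ?nnegrE//; [exact: ltW|by rewrite mulr_ge0// ltW|].
rewrite -ler_pdivrMl// mulrC (le_trans _ (expR_ge1Dx _))//.
by rewrite ler_wpDl.
Qed.

Let mg p : measurable_fun [set: R] (g p).
Proof.
apply: measurable_funM; first exact: measurable_powR.
by apply: measurableT_comp => //; exact: measurable_funN.
Qed.

Let integrable_g theta : 0 < theta ->
  mu.-integrable `]0, +oo[ (EFin \o g theta).
Proof.
move=> th0.
have h2 : 0 < (2^-1 : R) by rewrite invr_gt0.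
(* The factor 2 cancels the rate 1/2 in front of the exponential density. *)
pose C := (2 * theta) `^ theta * 2.
have iexp : mu.-integrable `]0, +oo[
    (fun x => C%:E * (exponential_pdf 2^-1 x)%:E)%E.
  apply: integrableZl => //.
  by apply: (@integrableS _ _ _ mu setT) => //; exact: integrable_exponential_pdf.
apply: (le_integrable _ _ _ iexp) => //.
  by apply/measurable_EFinP; exact: measurable_funTS (mg _).
move=> x /=; rewrite in_itv/= andbT => x0.
rewrite lee_fin !ger0_norm; last 2 first.
- by rewrite mulr_ge0 ?exponential_pdf_ge0 ?mulr_ge0 ?powR_ge0// ltW.
- by rewrite /g mulr_ge0 ?powR_ge0 ?expR_ge0.
rewrite (le_trans (powR_mul_expRN_le _ _ th0 (ltW x0)))//.
rewrite exponential_pdfE; last exact: ltW.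
have -> : - 2^-1 * x = - (x / 2) by rewrite mulNr mulrC.
by rewrite /C mulrA -(mulrA _ 2) divff// mulr1.
Qed.

Let continuous_g p x : 0 < x -> {for x, continuous (g p)}.
Proof.
move=> x0; apply: cvgM.
  exact: is_derive1_continuous (is_derive1_powR p x0).
apply: (@continuous_comp R R R -%R expR); last exact: continuous_expR.
exact: opp_continuous.
Qed.

(** Compact intervals away from 0 that exhaust the half-line; the bound [n.+2] gives [E 0 = [1, 2]]
    positive length. *)
Let E (n : nat) := `[(n.+1%:R^-1 : R), n.+2%:R]%classic.

Let mE n : measurable (E n : set (measurableTypeR R)).
Proof. exact: measurable_itv. Qed.

Let En n x : E n x -> 0 < x.
Proof.
by rewrite /E/= in_itv/= => /andP[+ _]; apply: lt_le_trans; rewrite invr_gt0.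
Qed.

Let UE : \bigcup_n E n = `]0, +oo[%classic.
Proof.
apply/seteqP; split => [x [n _] /En|x /=]; rewrite /= in_itv/= andbT// => x0.
pose m := Num.max x x^-1.
have m0 : 0 <= m by rewrite le_max ltW.
exists (Num.bound m) => //; rewrite /E/= in_itv/=.
have : m <= (Num.bound m)%:R by rewrite ltW// archi_boundP.
rewrite ge_max => /andP[h1 h2]; apply/andP; split.
  by rewrite invf_ple ?posrE// (le_trans h2)// ler_nat.
by rewrite (le_trans h1)// ler_nat (leq_addl 2).
Qed.

(** Monotone convergence in the extended reals, so it applies to [g (theta - 1)] before its integral
    is known to be finite. *)
Let cvg_E p : (\int[mu]_(x in E n) (g p x)%:E)%E @[n --> \oo] -->
  (\int[mu]_(x in `]0%R, +oo[) (g p x)%:E)%E.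
Proof.
rewrite -UE; apply: ge0_nondecreasing_set_cvg_integral => //.
- move=> i j ij; apply/subsetPset => x; rewrite /E/= !in_itv/= => /andP[h1 h2].
  apply/andP; split; last by rewrite (le_trans h2)// ler_nat !ltnS.
  by rewrite (le_trans _ h1)// lef_pV2 ?posrE// ler_nat !ltnS.
- by move=> n; apply/measurable_EFinP; exact: measurable_funTS (mg _).
- by move=> n x _; rewrite lee_fin /g mulr_ge0 ?powR_ge0 ?expR_ge0.
Qed.

Let integrable_E p n : mu.-integrable (E n) (EFin \o g p).
Proof.
apply: continuous_compact_integrable; first exact: segment_compact.
by apply: continuous_in_subspaceT => x /set_mem /En; exact: continuous_g.
Qed.

(** Integration by parts, read off from the derivative [theta * g (theta - 1) - g theta] of
    [g theta] on the positive axis. *)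
Let parts theta n :
  theta * (\int[mu]_(x in E n) g (theta - 1) x) =
  g theta n.+2%:R - g theta n.+1%:R^-1 + \int[mu]_(x in E n) g theta x.
Proof.
have ab : (n.+1%:R^-1 : R) < n.+2%:R.
  apply: (@le_lt_trans _ _ 1); last by rewrite ltr1n.
  by rewrite invf_le1// ler1n.
have dg x : 0 < x -> is_derive x 1 (g theta) (theta * g (theta - 1) x - g theta x).
  move=> x0; have d1 := is_derive1_powR theta x0.
  have d2 : is_derive x 1 (fun t : R => expR (- t)) (- expR (- x)).
    have hN : is_derive x 1 (-%R : R -> R) (-1) by apply: is_derive_eq.
    have := @is_derive1_comp _ expR _ x _ _ (is_derive_expR (- x)) hN.
    by rewrite mulrN1.
  rewrite /g; apply: is_derive_eq; rewrite /GRing.scale/=; ring.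
have := @continuous_FTC2 _ (fun x => theta * g (theta - 1) x - g theta x) (g theta)
  n.+1%:R^-1 n.+2%:R ab.
have pos x : x \in `[n.+1%:R^-1, n.+2%:R] -> 0 < x by move=> /En.
have cpos x : 0 < x -> {for x, continuous (g theta)}.
  by move=> x0; exact: continuous_g.
have h1 : {within E n, continuous (fun x => theta * g (theta - 1) x - g theta x)}.
  apply: continuous_in_subspaceT => x /set_mem /En x0.
  apply: cvgB; last exact: continuous_g.
  by apply: cvgM; [exact: cvg_cst|exact: continuous_g].
have iE : mu.-integrable (E n)
    (EFin \o (fun x => theta * g (theta - 1) x - g theta x)).
  by apply: continuous_compact_integrable => //; exact: segment_compact.
move=> /(_ h1) h.
have : ((\int[mu]_(x in E n) (theta * g (theta - 1) x - g theta x))%:E =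
  (g theta n.+2%:R)%:E - (g theta n.+1%:R^-1)%:E)%E.
  rewrite /Rintegral fineK; last first.
    exact: (integrable_fin_num (mE n) iE).
  apply: h.
  - split.
    + move=> x xE; have /dg[] // : 0 < x.
      by apply: pos; apply: subset_itv_oo_cc xE.
    + apply: cvg_at_right_filter; apply: cpos; by rewrite invr_gt0.
    + by apply: cvg_at_left_filter; apply: cpos.
  - move=> x xE; have /dg d : 0 < x by apply: pos; apply: subset_itv_oo_cc xE.
    by rewrite derive1E derive_val.
rewrite -EFinB => -[].
have iE1 := integrable_E (theta - 1) n; have iE2 := integrable_E theta n.
rewrite RintegralB//; last exact: (integrableZl (mE n) theta iE1).
by rewrite (RintegralZl _ (mE n) iE1) => <-; rewrite subrK.
Qed.

(** Let [n] tend to infinity in [parts]: the boundary terms vanish, and the integrals of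
    [g (theta - 1)] over [E n] converge to [theta^-1 * A], with [A] the value of
    [Gamma (theta + 1)]. Positivity is then checked on [A]. *)
Lemma Gamma_gt0_addr1 theta : 0 < theta ->
  0 < Gamma theta /\ Gamma (theta + 1) = theta * Gamma theta.
Proof.
move=> th0; rewrite /Gamma addrK -/(g theta) -/(g (theta - 1)).
set A := Rintegral mu _ (g theta).
have ig := integrable_g _ th0.
have fA : (\int[mu]_(x in `]0%R, +oo[) (g theta x)%:E)%E = A%:E.
  by rewrite /A /Rintegral fineK//; exact: integrable_fin_num.
have cA : \int[mu]_(x in E n) g theta x @[n --> \oo] --> A.
  by apply: fine_cvg; rewrite -fA; exact: cvg_E.
have cbd : g theta n.+2%:R - g theta n.+1%:R^-1 @[n --> \oo] --> 0.
  rewrite -[0]subr0; apply: cvgB.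
    (* At infinity, [exp (-u) <= 1 / (1 + u)] with [u = (n + 2) / 2] turns the exponential bound
       into a multiple of the harmonic sequence. *)
    apply: (@squeeze_cvgr _ _ _ _ (fun=> 0)
        (fun n => (2 * theta) `^ theta * 2 * harmonic n)); last 2 first.
    - exact: cvg_cst.
    - by rewrite -[0](mulr0 ((2 * theta) `^ theta * 2)); apply: cvgMr; exact: cvg_harmonic.
    apply: nearW => n; rewrite {1}/g mulr_ge0 ?powR_ge0 ?expR_ge0//=.
    rewrite (le_trans (powR_mul_expRN_le _ _ th0 _))// -mulrA.
    rewrite ler_pM2l ?powR_gt0 ?mulr_gt0// expRN -[leRHS]invrK lef_pV2 ?posrE ?expR_gt0//.
      rewrite (le_trans _ (expR_ge1Dx _))// /harmonic/= invfM invrK.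
      by have := ler0n R n.+1; rewrite -[n.+2%:R]natr1; lra.
  (* Near 0, the exponential is at most 1, which leaves [t^theta] at [t = 1 / (n + 1)]. *)
  apply: (@squeeze_cvgr _ _ _ _ (fun=> 0)
      (fun n => `|harmonic n| `^ theta)); last 2 first.
  - exact: cvg_cst.
  - have h0 : `|x| `^ theta @[x --> (0 : R)] --> (0 : R).
      have := continuous_normr_powR theta (ltW th0) 0.
      by rewrite /continuous_at normr0 powR0 ?gt_eqF.
    exact: (cvg_comp _ _ cvg_harmonic h0).
  apply: nearW => n; rewrite {1}/g mulr_ge0 ?powR_ge0 ?expR_ge0//=.
  rewrite ger0_norm ?harmonic_ge0// ler_piMr ?powR_ge0// /g.
have cB : \int[mu]_(x in E n) g (theta - 1) x @[n --> \oo] --> theta^-1 * A.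
  have -> : (fun n => \int[mu]_(x in E n) g (theta - 1) x) =
     (fun n => theta^-1 * (g theta n.+2%:R - g theta n.+1%:R^-1 +
                           \int[mu]_(x in E n) g theta x)).
    by apply/funext => n; rewrite -parts mulrA mulVf ?gt_eqF// mul1r.
  by apply: cvgMr; rewrite -[A]add0r; exact: cvgD.
have -> : Rintegral mu `]0, +oo[ (g (theta - 1)) = theta^-1 * A.
  rewrite /Rintegral.
  suff -> : (\int[mu]_(x in `]0%R, +oo[) (g (theta - 1) x)%:E)%E = (theta^-1 * A)%:E by [].
  apply: (cvg_unique _ (cvg_E (theta - 1))) => //.
  apply: cvg_EFin; last exact: cB.
  by apply: nearW => n; exact: (integrable_fin_num (mE n) (integrable_E _ n)).
split; last by rewrite mulrA divff ?gt_eqF// mul1r.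
rewrite mulr_gt0 ?invr_gt0//.
(* On [E 0 = [1, 2]] the integrand is at least [exp (-2)], because [x^theta >= 1] there. *)
apply: (@lt_le_trans _ _ (\int[mu]_(x in E 0) g theta x)); last first.
  rewrite -lee_fin -fA /Rintegral fineK; last exact: (integrable_fin_num (mE 0) (integrable_E _ 0)).
  apply: ge0_subset_integral => //.
  - by apply/measurable_EFinP; exact: measurable_funTS (mg _).
  - by move=> x _; rewrite lee_fin /g mulr_ge0 ?powR_ge0 ?expR_ge0.
  - by rewrite -UE; exact: bigcup_sup.
apply: (@lt_le_trans _ _ (\int[mu]_(x in E 0) expR (- 2))).
  have muE : (mu (E 0) = 1%:E)%E.
    rewrite /E invr1 lebesgue_measure_itv/= lte_fin ltr1n/=.
    by rewrite -EFinB; congr EFin; lra.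
  rewrite Rintegral_cst//; apply: mulr_gt0; first exact: expR_gt0.
  by have -> : fine (mu (E 0)) = 1 by rewrite muE.
apply: le_Rintegral => //.
  apply: continuous_compact_integrable; first exact: segment_compact.
  by apply: continuous_subspaceT => x; exact: cvg_cst.
move=> x; rewrite /E invr1/= in_itv/= => /andP[x1 x2].
rewrite /g -[leLHS]mul1r ler_pM ?expR_ge0// ?ler_expR ?lerN2//.
by rewrite -(powRr0 x) ler_powR// ltW.
Qed.

End gamma.

(** * Euler integrals, and integral forms of [C1] and [C2] *)

Section kernels.
Context {R : realType}.
Local Notation mu := (@lebesgue_measure R).
Implicit Types (a b c d p r x y t z theta alpha : R) (f F P Q phi : R -> R).

Lemma within_continuous_integrable a b f : {within `[a, b], continuous f} ->
  mu.-integrable `[a, b] (EFin \o f).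
Proof.
by move=> cf; apply: continuous_compact_integrable => //; exact: segment_compact.
Qed.

Lemma Rintegral_itv_oo_cc a b f : {within `[a, b], continuous f} ->
  \int[mu]_(x in `]a, b[) f x = \int[mu]_(x in `[a, b]) f x.
Proof.
move=> /within_continuous_integrable intf.
rewrite Rintegral_itv_bndo_bndc; last first.
  by apply: integrableS intf => //; exact: subset_itv_oo_cc.
rewrite Rintegral_itv_obnd_cbnd//.
by apply: integrableS intf => //; exact: subset_itv_oc_cc.
Qed.

Lemma is_derive_parameterized_integral a b f x :
  {within `[a, b], continuous f} -> x \in `]a, b[ ->
  is_derive x 1 (fun y => parameterized_integral mu a y f) (f x).
Proof.
move=> cf; rewrite in_itv/= => /andP[ax xb].
have intf := within_continuous_integrable _ _ _ cf.
have /(continuous_within_itvP _ (lt_trans ax xb))[cfoo _ _] := cf.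
have cfx : {for x, continuous f} by apply: cfoo; rewrite in_itv/= ax.
have [d1 d2] := continuous_FTC1_closed xb intf ax cfx.
by split; [exact: d1|rewrite -derive1E; exact: d2].
Qed.

Lemma parameterized_integral_self a f : parameterized_integral mu a a f = 0.
Proof. by rewrite /parameterized_integral set_itv1 Rintegral_set1. Qed.

(** The mean value theorem for the primitive from [a] writes the integral as [f c * (b - a)] with
    [c] interior, so [f] may vanish at the endpoints. *)
Lemma Rintegral_gt0 a b f : a < b -> {within `[a, b], continuous f} ->
  (forall x, x \in `]a, b[ -> 0 < f x) -> 0 < \int[mu]_(x in `[a, b]) f x.
Proof.
move=> ab cf f0.
have [] := @MVT _ (fun y => parameterized_integral mu a y f) f a b ab.
- by move=> x xab; exact: is_derive_parameterized_integral xab.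
- apply: parameterized_integral_continuous; first exact: ltW.
  exact: within_continuous_integrable.
move=> c cab; rewrite parameterized_integral_self subr0 => h.
by rewrite [ltRHS]h mulr_gt0 ?f0// subr_gt0.
Qed.

Lemma Rintegral_is_derive a b f F : a < b -> {within `[a, b], continuous f} ->
  {within `[a, b], continuous F} ->
  (forall x, x \in `]a, b[ -> is_derive x 1 F (f x)) ->
  \int[mu]_(x in `[a, b]) f x = F b - F a.
Proof.
move=> ab cf /(continuous_within_itvP _ ab)[cF Fa Fb] dF.
rewrite /Rintegral (@continuous_FTC2 _ f F _ _ ab cf)//.
- by split => // x /dF[].
- by move=> x /dF h; rewrite derive1E derive_val.
Qed.

Lemma within_continuous_powR01 p : 0 <= p ->
  {within `[0, 1], continuous (fun t : R => t `^ p)}.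
Proof.
move=> p0; apply: (@subspace_eq_continuous _ _ _ (fun t => (t - 0) `^ p)).
  by move=> t _; rewrite subr0.
exact: within_continuous_powR_subl.
Qed.

(** The integrand of [Beta (p + 1) (r + 1)]; after this shift, [p, r >= 0] gives continuity on the
    closed interval. *)
Definition beta_kernel p r t := t `^ p * (1 - t) `^ r.

Lemma within_continuous_beta_kernel p r : 0 <= p -> 0 <= r ->
  {within `[0, 1], continuous (beta_kernel p r)}.
Proof.
move=> p0 r0 x; apply: cvgM; first exact: (within_continuous_powR01 _ p0 x).
exact: (within_continuous_powR_subr 0 1 _ r0 x).
Qed.

Lemma BetaE p r : 0 <= p -> 0 <= r ->
  Beta (p + 1) (r + 1) = \int[mu]_(t in `[0, 1]) beta_kernel p r t.
Proof.
move=> p0 r0; rewrite /Beta !addrK Rintegral_itv_oo_cc//.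
exact: within_continuous_beta_kernel.
Qed.

Lemma Beta_gt0 p r : 0 <= p -> 0 <= r -> 0 < Beta (p + 1) (r + 1).
Proof.
move=> p0 r0; rewrite BetaE//; apply: Rintegral_gt0 => //.
  exact: within_continuous_beta_kernel.
move=> x; rewrite in_itv/= => /andP[x0 x1].
by rewrite mulr_gt0// powR_gt0// subr_gt0.
Qed.

(** Together with its mirror [Beta_1x], this identifies the factors [1 / (theta + 1)] and
    [1 / (theta + alpha + 1)] in [C1] and [C2] as the Beta values by which [hyp2F1] divides. *)
Lemma Beta_x1 p : 0 <= p -> Beta (p + 1) 1 = (p + 1)^-1.
Proof.
move=> p0; have p1 : p + 1 != 0 by rewrite gt_eqF// ltr_wpDl.
rewrite -[X in Beta _ X]add0r BetaE//.
pose F t := (p + 1)^-1 * (t - 0) `^ (p + 1).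
suff -> : \int[mu]_(t in `[0, 1]) beta_kernel p 0 t = F 1 - F 0.
  by rewrite /F !subr0 powR1 powR0// mulr0 subr0 mulr1.
apply: Rintegral_is_derive => //.
- exact: within_continuous_beta_kernel.
- move=> x; apply: cvgM; first exact: cvg_cst.
  by apply: (within_continuous_powR_subl 0 1 _ _ x); rewrite addr_ge0.
- move=> x; rewrite in_itv/= => /andP[x0 _].
  have h := is_derive_powR_subl 0 (p + 1) x x0.
  apply: is_derive_eq; rewrite /GRing.scale/= /beta_kernel powRr0 addrK subr0.
  by rewrite mulrA mulVf// mul1r mulr1.
Qed.

Lemma Beta_1x p : 0 <= p -> Beta 1 (p + 1) = (p + 1)^-1.
Proof.
move=> p0; have p1 : p + 1 != 0 by rewrite gt_eqF// ltr_wpDl.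
rewrite -[X in Beta X _]add0r BetaE//.
pose F t := - (p + 1)^-1 * (1 - t) `^ (p + 1).
suff -> : \int[mu]_(t in `[0, 1]) beta_kernel 0 p t = F 1 - F 0.
  by rewrite /F subrr subr0 powR1 powR0// mulr0 mulr1 sub0r opprK.
apply: Rintegral_is_derive => //.
- exact: within_continuous_beta_kernel.
- move=> x; apply: cvgM; first exact: cvg_cst.
  by apply: (within_continuous_powR_subr 0 1 _ _ x); rewrite addr_ge0.
- move=> x; rewrite in_itv/= => /andP[_ x1].
  have h := is_derive_powR_subr 1 (p + 1) x x1.
  apply: is_derive_eq; rewrite /GRing.scale/= /beta_kernel powRr0 addrK.
  by rewrite mulrNN mulrA mulVf// !mul1r.
Qed.

Lemma subrM_gt0 z t : z < 1 -> 0 <= t <= 1 -> 0 < 1 - z * t.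
Proof.
move=> z1 /andP[t0 t1].
have [->|tn0] := eqVneq t 0; first by rewrite mulr0 subr0.
have -> : 1 - z * t = (1 - t) + t * (1 - z) by ring.
by rewrite ltr_wpDl ?subr_ge0// mulr_gt0 ?subr_gt0// lt0r tn0.
Qed.

(** The integrand in Euler's formula for 2F1(2, p+1; p+r+2; z). *)
Definition euler_kernel z p r t := beta_kernel p r t * (1 - z * t) `^ (- 2).

Lemma within_continuous_euler_kernel z p r : z < 1 -> 0 <= p -> 0 <= r ->
  {within `[0, 1], continuous (euler_kernel z p r)}.
Proof.
move=> z1 p0 r0 x.
apply: cvgM; first exact: (within_continuous_beta_kernel _ _ p0 r0 x).
move: x; apply: continuous_in_subspaceT => x /set_mem/=.
rewrite in_itv/= => /andP[x0 x1].
have zx : 0 < 1 - z * x by rewrite subrM_gt0// x0.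
apply: (@continuous_comp R R R (fun t : R => 1 - z * t) (fun t : R => t `^ (- 2))).
  apply: cvgB; first exact: cvg_cst.
  by apply: cvgM; [exact: cvg_cst|exact: cvg_id].
exact: is_derive1_continuous (is_derive1_powR (- 2) zx).
Qed.

Lemma hyp2F1E z p r : z < 1 -> 0 <= p -> 0 <= r ->
  Beta (p + 1) (r + 1) * hyp2F1 2 (p + 1) (p + r + 2) z =
  \int[mu]_(t in `[0, 1]) euler_kernel z p r t.
Proof.
move=> z1 p0 r0; rewrite /hyp2F1.
have -> : p + r + 2 - (p + 1) = r + 1 by ring.
rewrite mulrA divff ?gt_eqF ?Beta_gt0// mul1r !addrK Rintegral_itv_oo_cc//.
exact: within_continuous_euler_kernel.
Qed.

(* Up to the factor b^-2, C1 and C2 are the integrals of the next two weights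
   for z = 1 - a / b. *)
Definition C1_weight theta z t := euler_kernel z theta 0 t + euler_kernel z 0 theta t.

Definition C2_weight theta alpha z t := C1_weight theta z t * (1 - t) `^ alpha.

Lemma within_continuous_C1_weight theta z : z < 1 -> 0 <= theta ->
  {within `[0, 1], continuous (C1_weight theta z)}.
Proof.
move=> z1 th0 x; apply: cvgD.
  exact: (within_continuous_euler_kernel z theta 0 z1 th0 (lexx _) x).
exact: (within_continuous_euler_kernel z 0 theta z1 (lexx _) th0 x).
Qed.

Lemma within_continuous_C2_weight theta alpha z : z < 1 -> 0 <= theta ->
  0 <= alpha -> {within `[0, 1], continuous (C2_weight theta alpha z)}.
Proof.
move=> z1 th0 al0 x; apply: cvgM.
  exact: (within_continuous_C1_weight theta z z1 th0 x).
exact: (within_continuous_powR_subr 0 1 _ al0 x).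
Qed.

Lemma C1E theta a b : 0 < a -> a < b -> 0 <= theta ->
  C1 theta a b = (b ^+ 2)^-1 * \int[mu]_(t in `[0, 1]) C1_weight theta (1 - a / b) t.
Proof.
move=> a0 ab th0; have b0 : 0 < b := lt_trans a0 ab.
have z1 : 1 - a / b < 1 by rewrite gtrBl divr_gt0.
have th1 : theta + 1 != 0 by rewrite gt_eqF// ltr_wpDl.
rewrite /C1 -mulrA; congr (_ * _).
rewrite RintegralD//; last 2 first.
- by apply: within_continuous_integrable; exact: within_continuous_euler_kernel.
- by apply: within_continuous_integrable; exact: within_continuous_euler_kernel.
rewrite mulrDr; congr (_ + _).
  have := hyp2F1E _ theta 0 z1 th0 (lexx _).
  by rewrite add0r (Beta_x1 _ th0) addr0.
have := hyp2F1E _ 0 theta z1 (lexx _) th0.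
by rewrite !add0r (Beta_1x _ th0).
Qed.

(** The factor [(1 - t)^alpha] joins [t^theta] to form a Beta kernel and merges with [(1 - t)^theta]
    into [(1 - t)^(theta + alpha)]; these are the two hypergeometric terms of [C2]. *)
Lemma C2E theta alpha a b : 0 < a -> a < b -> 0 <= theta -> 0 <= alpha ->
  C2 theta alpha a b =
  (b ^+ 2)^-1 * \int[mu]_(t in `[0, 1]) C2_weight theta alpha (1 - a / b) t.
Proof.
move=> a0 ab th0 al0; have b0 : 0 < b := lt_trans a0 ab.
have z1 : 1 - a / b < 1 by rewrite gtrBl divr_gt0.
have tha0 : 0 <= theta + alpha by rewrite addr_ge0.
rewrite /C2 [_ / b ^+ 2]mulrC -!mulrA -mulrDr; congr (_ * _).
rewrite hyp2F1E// -Beta_1x//.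
have -> : Beta 1 (theta + alpha + 1) *
    hyp2F1 2 1 (theta + alpha + 2) (1 - a / b) =
    \int[mu]_(t in `[0, 1]) euler_kernel (1 - a / b) 0 (theta + alpha) t.
  by have := hyp2F1E _ 0 _ z1 (lexx _) tha0; rewrite !add0r.
rewrite -RintegralD//; last 2 first.
- by apply: within_continuous_integrable; exact: within_continuous_euler_kernel.
- by apply: within_continuous_integrable; exact: within_continuous_euler_kernel.
(* On the open interval [1 - t] is nonzero, which licenses adding exponents by [powRD]. *)
rewrite -[RHS]Rintegral_itv_oo_cc; last exact: within_continuous_C2_weight.
rewrite -[LHS]Rintegral_itv_oo_cc; last first.
  move=> x; apply: cvgD.
    exact: (within_continuous_euler_kernel _ _ _ z1 th0 al0 x).
  exact: (within_continuous_euler_kernel _ _ _ z1 (lexx _) tha0 x).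
apply: eq_Rintegral => t; rewrite inE/= in_itv/= => /andP[t0 t1].
rewrite /C2_weight /C1_weight /euler_kernel /beta_kernel !powRr0 powRD; first by ring.
by apply/implyP => _; rewrite gt_eqF// subr_gt0.
Qed.

End kernels.

(** * Young's inequality with a parameter, and its optimisation *)

Section young.
Context {R : realType}.
Implicit Types (a b c d m p q r s x y t z theta alpha : R) (f F P Q phi : R -> R).

Lemma within_continuous_comp (A B : set R) (g f : R -> R) :
  {within B, continuous g} -> continuous f -> (forall x, A x -> B (f x)) ->
  {within A, continuous (g \o f)}.
Proof.
move=> /subspace_continuousP cg cf fAB.
apply/subspace_continuousP => x Ax U /(cg _ (fAB _ Ax)) /= h.
have h' : nbhs x (f @^-1` (fun y => B y -> U (g y))) by exact: cf x _ h.
suff : nbhs x (fun y => A y -> U (g (f y))) by [].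
by apply: filterS h' => y h'' Ay; apply: h''; exact: fAB.
Qed.

(** Young's inequality for the product of [y / s] and 1, with exponents [q] and [(1 - q^-1)^-1]. *)
Lemma powR_young q s y : 1 <= q -> 0 < s -> 0 <= y ->
  y <= s * ((1 - q^-1) + q^-1 * (y `^ q / s `^ q)).
Proof.
move=> q1 s0 y0; have q0 : 0 < q by rewrite (lt_le_trans ltr01).
rewrite -ler_pdivrMl// [leLHS]mulrC.
have -> : y `^ q / s `^ q = (y / s) `^ q.
  rewrite powRM ?invr_ge0 ?(ltW s0)//; congr (_ * _).
  by rewrite -[s^-1]powR_inv1 ?(ltW s0)// -powRrM mulN1r powRN.
have ys0 : 0 <= y / s by rewrite divr_ge0// ltW.
(* For [q = 1] the conjugate exponent is infinite, so this case is done by hand. *)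
move: q1; rewrite le_eqVlt => /predU1P[<-|q1].
  by rewrite invr1 subrr add0r mul1r powRr1.
have iq : 0 < 1 - q^-1 by rewrite subr_gt0 invf_lt1.
have := @conjugate_powR _ _ 1 q (1 - q^-1)^-1 ys0 ler01 q0.
rewrite invr_gt0 invrK subrKC powR1 mul1r mulr1 => /(_ iq erefl).
by rewrite addrC [_ / q]mulrC.
Qed.

(** The right-hand side of the conclusion is the infimum over [s] of the bounds in the
    hypothesis. *)
Lemma powR_young_optimize q T C D : 1 <= q -> 0 < C -> 0 <= D ->
  (forall s, 0 < s -> T <= s * ((1 - q^-1) * C + q^-1 * (D / s `^ q))) ->
  T <= C `^ (1 - q^-1) * D `^ q^-1.
Proof.
move=> q1 C0; have q0 : 0 < q by rewrite (lt_le_trans ltr01).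
rewrite le_eqVlt => /predU1P[<-|D0] hT.
  apply: (@le_trans _ _ 0); last by rewrite mulr_ge0 ?powR_ge0.
  (* For [D = 0] the infimum is approached as [s] tends to 0: the choice [s = e / C] leaves at most
     [e]. *)
  apply/ler_addgt0Pl => e e0; rewrite addr0.
  have := hT (e / C) (divr_gt0 e0 C0).
  rewrite mul0r mulr0 addr0 => /le_trans; apply.
  rewrite mulrCA -mulrA mulVf ?gt_eqF// mulr1.
  by apply: ler_piMl; rewrite ?gerBl ?invr_ge0 ltW.
(* The optimal [s] satisfies [s^q = D / C]. Then [D / s^q = C], the two weights add up to 1, and the
   bound becomes [s * C]. *)
have s0 : 0 < (D / C) `^ q^-1 by rewrite powR_gt0// divr_gt0.
have := hT _ s0; rewrite -powRrM mulVf ?gt_eqF// powRr1 ?divr_ge0 ?(ltW D0) ?(ltW C0)//.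
have DCD : D * (C / D) = C by rewrite mulrCA divff ?gt_eqF// mulr1.
rewrite invf_div DCD -mulrDl subrK mul1r.
move=> /le_trans; apply; rewrite powRM ?invr_ge0 ?(ltW D0) ?(ltW C0)//.
rewrite le_eqVlt; apply/orP; left.
have -> : C `^ (1 - q^-1) = C * C `^ (- q^-1).
  rewrite powRD ?powRr1 ?(ltW C0)//.
  by apply/implyP => _; rewrite gt_eqF.
rewrite -[C^-1]powR_inv1 ?(ltW C0)// -powRrM mulN1r.
by apply/eqP; ring.
Qed.

(** Used to place all of [[a, b]] in the interior, where [f] is differentiable. *)
Lemma interior_itv_mem (I : set R) a b x : is_interval I ->
  interior I a -> interior I b -> a <= x <= b -> interior I x.
Proof.
move=> itvI Ia Ib /andP[]; rewrite le_eqVlt => /predU1P[<-//|ax].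
rewrite le_eqVlt => /predU1P[->//|xb].
have : `]a, b[ `<=` I.
  move=> y; rewrite /= in_itv/= => /andP[ay yb].
  by apply: (itvI a b); [exact: interior_subset|exact: interior_subset|rewrite !ltW].
move=> sub; apply: (filterS sub); apply: open_nbhs_nbhs; split.
  exact: interval_open.
by rewrite /= in_itv/= ax.
Qed.

End young.

(** * Bound on [If] from a majorant of the derivative *)

Section weighted_bound.
Context {R : realType}.
Local Notation mu := (@lebesgue_measure R).
Implicit Types (a b c d m p q r s x y t z theta alpha : R) (f F P Q phi : R -> R).

(** The reciprocal interval [[c, d]] has length [(b - a) / (a b)], the inverse of the base in [If],
    and [Gamma (theta + 1) = theta * Gamma theta] cancels the normalisation of the two integrals. *)
Lemma If_trapezoidE f theta a b : 0 < a -> a < b -> 0 < theta ->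
  let c := 1 / b in let d := 1 / a in let phi := f \o (fun x => 1 / x) in
  If f theta a b = (2 * (d - c) `^ theta)^-1 *
   ((d - c) `^ theta * (phi c + phi d) -
    theta * (\int[mu]_(x in `[c, d]) ((x - c) `^ (theta - 1) * phi x) +
             \int[mu]_(x in `[c, d]) ((d - x) `^ (theta - 1) * phi x))).
Proof.
move=> a0 ab th0 c d phi; have b0 := lt_trans a0 ab.
have [G0 Grec] := Gamma_gt0_addr1 theta th0.
rewrite /If /RL_right /RL_left Grec -/c -/d -/phi.
have -> : f a = phi d by rewrite /phi/= /d !div1r invrK.
have -> : f b = phi c by rewrite /phi/= /c !div1r invrK.
have dc0 : 0 < d - c by rewrite subr_gt0 /c /d !div1r ltf_pV2 ?posrE.
have -> : a * b / (b - a) = (d - c)^-1.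
  by rewrite /d /c; field; rewrite !gt_eqF ?subr_gt0//=; nra.
have -> : (d - c)^-1 `^ theta = ((d - c) `^ theta)^-1.
  by rewrite -[_^-1]powR_inv1 ?(ltW dc0)// -powRrM mulN1r powRN.
set I1 := Rintegral _ _ _; set I2 := Rintegral _ _ _.
have L0 : (d - c) `^ theta != 0 by rewrite gt_eqF// powR_gt0.
by field; rewrite L0 gt_eqF.
Qed.

(** The majorant is affine in [(1 - t)^alpha], so its integral against the kernel combines [C1] and
    [C2]. No sign is imposed on [e1] and [e2]: the [e2] used later may be negative. *)
Lemma If_weighted_bound f theta alpha a b (e1 e2 : R) :
  0 < a -> a < b -> 0 < theta -> 0 <= alpha ->
  (forall x, a <= x <= b -> derivable f x 1) ->
  (forall t, 0 < t < 1 ->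
     `|derive1 f (a * b / (t * a + (1 - t) * b))| <= e1 + e2 * (1 - t) `^ alpha) ->
  `|If f theta a b| <=
  a * b * (b - a) / 2 * (e1 * C1 theta a b + e2 * C2 theta alpha a b).
Proof.
move=> a0 ab th0 al0 df hf; have b0 := lt_trans a0 ab.
rewrite If_trapezoidE//.
set c := 1 / b; set d := 1 / a; set phi := f \o _.
have cE : c = b^-1 by rewrite /c div1r.
have dE : d = a^-1 by rewrite /d div1r.
have c0 : 0 < c by rewrite cE invr_gt0.
have cd : c < d by rewrite cE dE ltf_pV2 ?posrE.
set L := d - c; have L0 : 0 < L by rewrite subr_gt0.
have Lth0 : 0 < L `^ theta by rewrite powR_gt0.
pose z := 1 - a / b.
have z1 : z < 1 by rewrite gtrBl divr_gt0.
have cV := within_continuous_C1_weight theta z z1 (ltW th0).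
have cV' := within_continuous_C2_weight theta alpha z z1 (ltW th0) al0.
have iV := within_continuous_integrable _ _ _ cV.
have iV' := within_continuous_integrable _ _ _ cV'.
(* [L] offsets the [L^-1] of the substitution below, [L^theta] comes from the powers of [x - c] and
   [d - x], and [a^2] from [x^-2 = a^2 (1 - z t)^-2]. *)
pose k := L * L `^ theta * a ^+ 2.
pose w t := k * e1 * C1_weight theta z t + k * e2 * C2_weight theta alpha z t.
have cw : {within `[0, 1], continuous w}.
  by move=> x; apply: cvgD; apply: cvgM; try exact: cvg_cst;
    [exact: cV|exact: cV'].
pose B t := parameterized_integral mu 0 t w.
have cB : {within `[0, 1], continuous B}.
  apply: parameterized_integral_continuous => //.
  exact: within_continuous_integrable.
(* The substitution [t = tau x] sends [d] to 0 and [c] to 1, and gives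
   [1 / x = a b / (t a + (1 - t) b)]. *)
pose tau x := (d - x) / L.
have tau01 x : x \in `]c, d[ -> 0 < tau x < 1.
  rewrite in_itv/= => /andP[cx xd]; rewrite /tau divr_gt0 ?subr_gt0//=.
  by rewrite ltr_pdivrMr// mul1r /L ltrD2l ltrN2.
have dtau x : is_derive x 1 tau (- L^-1).
  rewrite /tau; apply: is_derive_eq; rewrite /GRing.scale/=; ring.
have ctau : continuous tau by move=> x; exact: is_derive1_continuous (dtau x).
(* As [tau] decreases, the minus sign gives the majorant the derivative [L^-1 * w (tau x)]. *)
have cQ : {within `[c, d], continuous (fun x => - B (tau x))}.
  move=> x; apply: cvgN; move: x.
  apply: (within_continuous_comp _ _ _ _ cB ctau) => x /=.
  rewrite !in_itv/= => /andP[cx xd]; rewrite /tau divr_ge0 ?subr_ge0 ?(ltW cd)//=.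
  by rewrite ler_pdivrMr// mul1r /L lerD2l lerN2.
have dQ x : x \in `]c, d[ -> is_derive x 1 (fun y => - B (tau y)) (L^-1 * w (tau x)).
  move=> xcd; have dB : is_derive (tau x) 1 B (w (tau x)).
    by apply: (is_derive_parameterized_integral _ _ _ _ cw); rewrite in_itv/= tau01.
  have := @is_derive1_comp _ B tau x _ _ dB (dtau x) => h.
  by apply: is_derive_eq; rewrite mulrN opprK mulrC.
have dphi x : c <= x <= d ->
    is_derive x 1 phi (derive1 f (1 / x) * - x ^- 2).
  move=> /andP[cx xd]; have x0 : 0 < x by rewrite (lt_le_trans c0).
  have fx : is_derive (1 / x) 1 f (derive1 f (1 / x)).
    rewrite derive1E; apply: DeriveDef => //; apply: df; rewrite div1r.
    by rewrite -[a]invrK -[b]invrK -dE -cE !lef_pV2 ?posrE ?(lt_trans c0 cd)// xd.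
  have hV : is_derive x 1 (fun x : R => 1 / x) (- x ^- 2).
    have h : is_derive x 1 (fun x : R => x^-1) (- x ^- 2 *: 1).
      by apply: (@is_deriveV _ id); rewrite ?gt_eqF.
    by apply: is_derive_eq; rewrite /GRing.scale/=; ring.
  exact: is_derive1_comp.
have cphi : {within `[c, d], continuous phi}.
  apply: continuous_in_subspaceT => x /set_mem/=; rewrite in_itv/= => xcd.
  exact: is_derive1_continuous (dphi x xcd).
have key x : x \in `]c, d[ ->
  `|((x - c) `^ theta - (d - x) `^ theta) * (derive1 f (1 / x) * - x ^- 2)|
   <= L^-1 * w (tau x).
  move=> xcd; have /andP[t0 t1] := tau01 _ xcd.
  have xE : x = (1 - z * tau x) / a.
    rewrite /tau /z /L /d /c; field.
    by rewrite mulN1r !gt_eqF ?subr_gt0.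
  have zt0 : 0 < 1 - z * tau x.
    by move: xcd; rewrite in_itv/= => /andP[cx _]; have := lt_trans c0 cx;
      rewrite {1}xE pmulr_lgt0// invr_gt0.
  have xcE : x - c = L * (1 - tau x).
    by rewrite /tau /L; field; rewrite gt_eqF.
  have dxE : d - x = L * tau x.
    by rewrite /tau mulrC divfK// gt_eqF.
  have fE : 1 / x = a * b / (tau x * a + (1 - tau x) * b).
    have zE : 1 - z * tau x = (tau x * a + (1 - tau x) * b) / b.
      by rewrite /z; field; rewrite gt_eqF.
    have A0 : tau x * a + (1 - tau x) * b != 0.
      by move: zt0; rewrite zE pmulr_lgt0 ?invr_gt0// => /gt_eqF ->.
    rewrite {1}xE zE; field.
    by rewrite A0 !gt_eqF.
  have := hf (tau x); rewrite t0 t1 => /(_ isT); rewrite -fE => hfx.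
  have L0' := ltW L0; have t0' := ltW t0.
  have t1' : 0 <= 1 - tau x by rewrite subr_ge0 ltW.
  rewrite xcE dxE (powRM _ L0' t1') (powRM _ L0' t0').
  rewrite -mulrBr !normrM normrN (ger0_norm (powR_ge0 _ _)).
  have zE : (1 - z * tau x) `^ (- 2) = (1 - z * tau x) ^- 2.
    by rewrite powRN powR_mulrn// ltW.
  have -> : `|x ^- 2| = a ^+ 2 * (1 - z * tau x) `^ (- 2).
    rewrite zE ger0_norm ?invr_ge0 ?sqr_ge0// {1}xE; field.
    by rewrite !gt_eqF.
  have -> : L^-1 * w (tau x) = L `^ theta * (tau x `^ theta + (1 - tau x) `^ theta) *
      ((e1 + e2 * (1 - tau x) `^ alpha) * (a ^+ 2 * (1 - z * tau x) `^ (- 2))).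
    rewrite /w /C2_weight /C1_weight /euler_kernel /beta_kernel !powRr0 /k.
    by field; rewrite gt_eqF.
  (* The difference of powers is bounded by their sum, whence the two terms of [C1_weight]; the
     other factor is the hypothesis [hf]. *)
  apply: ler_pM.
  - by rewrite mulr_ge0 ?powR_ge0.
  - by apply: mulr_ge0 => //; apply: mulr_ge0; rewrite ?sqr_ge0 ?powR_ge0.
  - rewrite ler_pM2l// (le_trans (ler_normB _ _))//.
    by rewrite !ger0_norm ?powR_ge0// addrC.
  - by rewrite ler_pM2r// mulr_gt0 ?exprn_gt0 ?powR_gt0.
have dphi' x : x \in `]c, d[ -> is_derive x 1 phi (derive1 f (1 / x) * - x ^- 2).
  by rewrite in_itv/= => /andP[cx xd]; apply: dphi; rewrite !ltW.
have := RL_trapezoid_bound _ _ _ _ _ _ _ cd th0 cphi dphi' cQ dQ key.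
(* Here [L * a^2 = a b (b - a) / b^2], and [b^-2] is the factor in [C1E] and [C2E]. *)
have -> : - B (tau d) - - B (tau c) = L `^ theta * (a * b * (b - a)) *
    (e1 * C1 theta a b + e2 * C2 theta alpha a b).
  rewrite /tau subrr mul0r divff ?gt_eqF// /B parameterized_integral_self oppr0 add0r opprK.
  rewrite /parameterized_integral /w RintegralD//; last 2 first.
  - exact: (integrableZl _ _ iV).
  - exact: (integrableZl _ _ iV').
  rewrite !RintegralZl// C1E ?(ltW th0)// C2E ?(ltW th0)// -/z /k /L /d /c.
  by field; rewrite !gt_eqF.
rewrite normrM [`|_^-1|]ger0_norm; last by rewrite invr_ge0 mulr_ge0// powR_ge0.
set X := `|_|; set S := e1 * _ + _ => hX.
rewrite -/L ler_pdivrMl ?mulr_gt0// (le_trans hX)// le_eqVlt; apply/orP; left.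
by apply/eqP; field.
Qed.

End weighted_bound.

(** * Signs of the constants *)

Section constants.
Context {R : realType}.
Local Notation mu := (@lebesgue_measure R).

Lemma C1_weight_gt0 (theta z t : R) : z < 1 -> 0 < t < 1 -> 0 < C1_weight theta z t.
Proof.
move=> z1 /andP[t0 t1].
have zt : 0 < 1 - z * t by rewrite subrM_gt0// !ltW.
by rewrite /C1_weight /euler_kernel /beta_kernel addr_gt0// !mulr_gt0// powR_gt0// subr_gt0.
Qed.

Lemma C1_gt0 (theta a b : R) : 0 < a -> a < b -> 0 <= theta -> 0 < C1 theta a b.
Proof.
move=> a0 ab th0; have b0 := lt_trans a0 ab.
have z1 : 1 - a / b < 1 by rewrite gtrBl divr_gt0.
rewrite C1E// mulr_gt0 ?invr_gt0 ?exprn_gt0//; apply: Rintegral_gt0 => //.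
  exact: within_continuous_C1_weight.
by move=> t; rewrite in_itv/= => t01; exact: C1_weight_gt0.
Qed.

(** The two weights differ by the factor [(1 - t)^alpha], which lies in [[0, 1]]. The upper bound
    says that [C3] is nonnegative. *)
Lemma C2_ge0_le_C1 (theta alpha a b : R) : 0 < a -> a < b -> 0 <= theta -> 0 <= alpha ->
  0 <= C2 theta alpha a b <= C1 theta a b.
Proof.
move=> a0 ab th0 al0; have b0 := lt_trans a0 ab.
have z1 : 1 - a / b < 1 by rewrite gtrBl divr_gt0.
have cV := within_continuous_C1_weight theta _ z1 th0.
have cV' := within_continuous_C2_weight theta alpha _ z1 th0 al0.
have b2 : 0 < (b ^+ 2)^-1 by rewrite invr_gt0 exprn_gt0.
rewrite C2E// C1E// pmulr_rge0// ler_pM2l//.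
rewrite -!Rintegral_itv_oo_cc//; apply/andP; split.
  apply: Rintegral_ge0 => t /=; rewrite in_itv/= => t01.
  by rewrite mulr_ge0 ?powR_ge0// ltW// C1_weight_gt0.
have sub : `]0, 1[%classic `<=` (`[0, 1]%classic : set R) by exact: subset_itv_oo_cc.
apply: le_Rintegral => //.
- by apply: integrableS (within_continuous_integrable _ _ _ cV').
- by apply: integrableS (within_continuous_integrable _ _ _ cV).
move=> t /=; rewrite in_itv/= => /andP[t0 t1].
rewrite ler_piMr//; first by rewrite ltW// C1_weight_gt0// t0.
by rewrite -[leRHS](powRr0 (1 - t)) ger_powR//; lra.
Qed.

End constants.

(** * Convexity, Young's inequality and optimisation combined *)

Theorem theorem5 (R : realType) (I : set R) (f : R -> R)
    (m alpha q theta a b : R) :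
  is_interval I ->
  (forall x, I x -> 0 < x) ->
  (forall x, interior I x -> derivable f x 1) ->
  0 < m -> m <= 1 -> 0 <= alpha -> alpha <= 1 -> 1 <= q -> 0 < theta ->
  a < b -> interior I a -> interior I (b / m) ->
  (@lebesgue_measure R).-integrable `[a, b] (EFin \o (derive1 f)) ->
  harm_am_convex alpha m `[a, b / m] (fun x => `|(derive1 f) x| `^ q) ->
  `|If f theta a b|
    <= a * b * (b - a) / 2 * (C1 theta a b) `^ (1 - 1 / q) *
       (C2 theta alpha a b * `|(derive1 f) a| `^ q
        + m * C3 theta alpha a b * `|(derive1 f) (b / m)| `^ q) `^ (1 / q).
Proof.
move=> itvI Ipos df m0 m1 al0 _ q1 th0 ab Ia Ibm _ hconv.
have a0 : 0 < a := Ipos _ (interior_subset Ia).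
have b0 := lt_trans a0 ab.
have bbm : b <= b / m by rewrite ler_pdivlMr// ler_piMr// ltW.
set ha := `|derive1 f a| `^ q; set hb := `|derive1 f (b / m)| `^ q.
have ha0 : 0 <= ha by exact: powR_ge0.
have hb0 : 0 <= hb by exact: powR_ge0.
have C10 := C1_gt0 theta a b a0 ab (ltW th0).
have /andP[C20 C21] := C2_ge0_le_C1 theta alpha a b a0 ab (ltW th0) al0.
have C30 : 0 <= C3 theta alpha a b by rewrite /C3 subr_ge0.
have dfab x : a <= x <= b -> derivable f x 1.
  move=> /andP[ax xb]; apply: df; apply: (interior_itv_mem _ _ _ _ itvI Ia Ibm).
  by rewrite ax (le_trans xb).
have hf t : 0 < t < 1 ->
    `|derive1 f (a * b / (t * a + (1 - t) * b))| `^ q <=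
    (1 - t) `^ alpha * ha + m * (1 - (1 - t) `^ alpha) * hb.
  move=> /andP[t0 t1].
  have A0 : 0 < t * a + (1 - t) * b by rewrite addr_gt0// mulr_gt0// subr_gt0.
  (* Convexity is used at the points [a] and [b / m] with parameter [1 - t]; the factor [m] then
     cancels in the argument. *)
  have xE : m * a * (b / m) / (m * (1 - t) * (b / m) + (1 - (1 - t)) * a) =
      a * b / (t * a + (1 - t) * b).
    field.
    by rewrite [X in X != 0](_ : _ = t * a + (1 - t) * b) ?gt_eqF//; ring.
  have := hconv a (b / m) (1 - t); rewrite xE; apply.
  - by rewrite /= in_itv/= lexx (le_trans (ltW ab)).
  - by rewrite /= in_itv/= lexx (le_trans (ltW ab)).
  - by apply/andP; split; lra.
  (* The argument is a weighted harmonic mean of [a] and [b], so it lies between [a] and [b], and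
     [b <= b / m]. *)
  - rewrite /= in_itv/= ler_pdivlMr// ler_pM2l// ler_pdivrMr//.
    apply/andP; split; first by nra.
    apply: (@le_trans _ _ (b * (t * a + (1 - t) * b))); last by rewrite ler_wpM2r// ltW.
    by rewrite mulrC ler_pM2l//; nra.
pose K := a * b * (b - a) / 2.
have K0 : 0 < K by rewrite divr_gt0// !mulr_gt0// subr_gt0.
(* After division by [K], the optimisation runs with [C = C1] and [D] the bracket, nonnegative
   because [C2] and [C3] are. *)
rewrite -/K -mulrA -ler_pdivrMl// !div1r; apply: powR_young_optimize => //.
  exact: addr_ge0 (mulr_ge0 C20 ha0) (mulr_ge0 (mulr_ge0 (ltW m0) C30) hb0).
move=> s s0; rewrite ler_pdivrMl//.
have sq0 : 0 < s `^ q by rewrite powR_gt0.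
have q0 : 0 < q := lt_le_trans ltr01 q1.
(* [e1] and [e2] are the constant term and the coefficient of [(1 - t)^alpha] once the convexity
   bound is inserted into Young's inequality. *)
pose e1 := s * ((1 - q^-1) + q^-1 * (m * hb / s `^ q)).
pose e2 := s * (q^-1 * ((ha - m * hb) / s `^ q)).
have -> : s * ((1 - q^-1) * C1 theta a b + q^-1 *
    ((C2 theta alpha a b * ha + m * C3 theta alpha a b * hb) / s `^ q)) =
    e1 * C1 theta a b + e2 * C2 theta alpha a b.
  by rewrite /e1 /e2 /C3; field; rewrite !gt_eqF.
apply: If_weighted_bound => // t t01.
rewrite (le_trans (powR_young _ _ _ q1 s0 (normr_ge0 _)))//.
have -> : e1 + e2 * (1 - t) `^ alpha = s * ((1 - q^-1) + q^-1 *
    (((1 - t) `^ alpha * ha + m * (1 - (1 - t) `^ alpha) * hb) / s `^ q)).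
  by rewrite /e1 /e2; field; rewrite !gt_eqF.
by rewrite ler_pM2l// lerD2l ler_pM2l ?invr_gt0// ler_pM2r ?invr_gt0// hf.
Qed.
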